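(* Let $M_0=\begin{pmatrix} x_1 & x_2 & x_3\\ y_1 & y_2 & y_3\end{pmatrix}$ be an integer matrix with $\frac{y_1}{x_1}<\frac{y_2}{x_2}<\frac{y_3}{x_3}$, put $Y_{ij}=x_iy_j-x_jy_i$ for $i<j$, and suppose $Y_{12},Y_{13},Y_{23}$ are pairwise relatively prime. For $\mathbf n=(n_1,n_2)^T\in\overline\Omega_1\cap\mathbb Z^2$, $$f(M_0,\mathbf n)<\frac{Y_{12}Y_{13}-Y_{12}-Y_{13}+1}{n_2x_1-n_1y_1}.$$ For $\mathbf n=(n_1,n_2)^T\in\overline\Omega_2\cap\mathbb Z^2$, $$f(M_0,\mathbf n)<\frac{Y_{23}Y_{13}-Y_{23}-Y_{13}+1}{n_1y_3-n_2x_3}.$$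
   Context: $f(M_0,\mathbf n)$ denotes the largest integer $N$ for which the linear Diophantine system $M_0\mathbf x=N\mathbf n$ has no solution $\mathbf x\in\mathbb Z_{\ge0}^3$. The convex hull of the columns of $M_0$ is assumed not to contain the origin. $\mathrm{cone}(M_0)$ is the set of nonnegative real combinations of the columns of $M_0$; $\Omega_1=\{(x,y)^T\in\mathrm{cone}(M_0): \frac{y_1}{x_1}<\frac yx<\frac{y_2}{x_2}\}$ and $\Omega_2=\{(x,y)^T\in\mathrm{cone}(M_0): \frac{y_2}{x_2}<\frac yx<\frac{y_3}{x_3}\}$, and the bar denotes closure.
   Formalization: Adds that x_1, x_2, x_3 all have the same sign (the claim fails for columns (1,1), (-3,-4), (-1,-2) with n = (-3,-4)); n is nonzero; where the denominator is 0, only the existence of f is stated. *)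

(* Defs.v *)
From HB Require Import structures.
From mathcomp Require Import all_boot all_order all_algebra.
From mathcomp Require Import all_classical all_reals all_analysis.
Set Implicit Arguments.
Unset Strict Implicit.
Unset Printing Implicit Defensive.
Import Order.TTheory GRing.Theory Num.Theory.
Import numFieldNormedType.Exports.
Local Open Scope classical_set_scope.
Local Open Scope ring_scope.

(* Indices of columns and rows start at 0: the columns (x_1, y_1)^T,
   (x_2, y_2)^T, (x_3, y_3)^T of M0 are those of index 0, 1, 2. *)
Definition xc (M0 : 'M[int]_(2, 3)) (i : 'I_3) : int := M0 0 i.
Definition yc (M0 : 'M[int]_(2, 3)) (i : 'I_3) : int := M0 1 i.

Definition Y (M0 : 'M[int]_(2, 3)) (i j : 'I_3) : int :=
  xc M0 i * yc M0 j - xc M0 j * yc M0 i.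

Section RealGeometry.
Variable R : realType.

(* y / x; where x = 0 this is the default value 0, so every use below comes
   with a condition that forces x != 0. *)
Definition slope (v : 'cV[R]_2) : R := v 1 0 / v 0 0.

Definition toRmx (m n : nat) (A : 'M[int]_(m, n)) : 'M[R]_(m, n) :=
  map_mx (fun z : int => z%:~R) A.

Definition col_slope (M0 : 'M[int]_(2, 3)) (i : 'I_3) : R :=
  slope (toRmx (col i M0)).

Definition cone (M0 : 'M[int]_(2, 3)) : set 'cV[R]_2 :=
  [set v | exists t : 'cV[R]_3,
     (forall i, 0 <= t i 0) /\ v = toRmx M0 *m t].

Definition col_hull (M0 : 'M[int]_(2, 3)) : set 'cV[R]_2 :=
  [set v | exists t : 'cV[R]_3,
     [/\ forall i, 0 <= t i 0, \sum_i t i 0 = 1 & v = toRmx M0 *m t]].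

(* Open sector of the cone between columns i and j: Omega_1 is the sector
   (0, 1) and Omega_2 is the sector (1, 2). *)
Definition Omega (M0 : 'M[int]_(2, 3)) (i j : 'I_3) : set 'cV[R]_2 :=
  [set v | [/\ cone M0 v, v 0 0 != 0 &
               col_slope M0 i < slope v < col_slope M0 j]].

End RealGeometry.

Definition solvable_at (M0 : 'M[int]_(2, 3)) (n : 'cV[int]_2) (N : int) : Prop :=
  exists x : 'cV[int]_3, (forall i, 0 <= x i 0) /\ M0 *m x = N *: n.

(* N = f(M0, n).  N ranges over all integers: f can be -1, and it does not
   exist for n = 0, where every N is solvable. *)
Definition is_f (M0 : 'M[int]_(2, 3)) (n : 'cV[int]_2) (N : int) : Prop :=
  ~ solvable_at M0 n N /\
  forall N' : int, ~ solvable_at M0 n N' -> N' <= N.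

(* f(M0, n) exists and is < a / d.  For d = 0 (n on the boundary ray of the
   cone) the quotient is undefined, and only the existence of f(M0, n) is
   stated. *)
Definition f_lt_quot (M0 : 'M[int]_(2, 3)) (n : 'cV[int]_2) (a d : int) : Prop :=
  exists N : int, is_f M0 n N /\ (d != 0 -> N%:~R < a%:~R / d%:~R :> rat).

(* Main.v *)
(** Apply [det(c_1, .)] to [a c_1 + b c_2 + c c_3 = N n]: it becomes
    [b Y_12 + c Y_13 = N det(c_1, n)], which by Sylvester has a solution
    [b, c >= 0] as soon as [N det(c_1, n) >= (Y_12 - 1)(Y_13 - 1)].  As [Y_12]
    and [Y_13] are coprime, [c_1] is primitive, so that [N n - b c_2 - c c_3],
    being parallel to [c_1], is an integer multiple [a c_1].  Finally
    [a Y_12 = N det(n, c_2) + c Y_23 >= 0] because [n] lies in the sector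
    between [c_1] and [c_2].  The second claim is the same argument with the
    coordinates exchanged and the columns in the reverse order. *)
Require Import Defs.
From HB Require Import structures.
From mathcomp Require Import all_boot all_order all_algebra.
From mathcomp Require Import all_classical all_reals all_analysis.
From mathcomp Require Import ring zify.
Set Implicit Arguments.
Unset Strict Implicit.
Unset Printing Implicit Defensive.
Import Order.TTheory GRing.Theory Num.Theory.
Import numFieldNormedType.Exports.
Local Open Scope classical_set_scope.
Local Open Scope ring_scope.

(** * Nonnegative integer combinations in the plane *)

Lemma sylvester_frobenius (A B D : int) : 0 < A -> 0 < B -> coprimez A B ->
  (A - 1) * (B - 1) <= D ->
  exists b c : int, [/\ 0 <= b, 0 <= c & D = b * A + c * B].
Proof.
move=> A0 B0 /coprimezP[[u w] /= uw] leD.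
pose b := (D * u %% B)%Z; pose q := (D * u %/ B)%Z.
have bE : D * u = q * B + b by exact: divz_eq.
have b0 : 0 <= b by rewrite modz_ge0 // gt_eqF.
have bB : b < B by rewrite ltz_pmod.
have DE : D = b * A + (q * A + D * w) * B.
  transitivity (D * (u * A + w * B)); first by rewrite uw mulr1.
  transitivity (D * u * A + D * w * B); first by ring.
  by rewrite bE; ring.
exists b, (q * A + D * w); split=> //.
(* As [b <= B - 1], [c * B >= (A - 1) * (B - 1) - (B - 1) * A = 1 - B > - B], so [c > -1]. *)
move: (q * A + D * w) DE => c DE; nia.
Qed.

(** Stated for bare vectors [p], [q], [r], [v], so that it serves both sectors. The alternative
    [D = 0] covers [N = 0] and [v] on the line of [p], where [D] may lie below the Sylvester
    bound. *)
Lemma sector_nneg_combination (px py qx qy rx ry vx vy : int) :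
  let A := px * qy - qx * py in let B := px * ry - rx * py in
  let D := px * vy - vx * py in
  0 < A -> 0 < B -> 0 <= qx * ry - rx * qy -> coprimez A B ->
  0 <= vx * qy - qx * vy -> D = 0 \/ (A - 1) * (B - 1) <= D ->
  exists a b c : int, [/\ 0 <= a, 0 <= b, 0 <= c,
    a * px + b * qx + c * rx = vx & a * py + b * qy + c * ry = vy].
Proof.
move=> A B D A0 B0 C0 cAB E0 hD.
have [b [c [b0 c0 DE]]] :
    exists b c : int, [/\ 0 <= b, 0 <= c & D = b * A + c * B].
  case: hD => [->|hD]; last exact: sylvester_frobenius.
  by exists 0, 0; rewrite !mul0r addr0.
have /coprimezP[[u w] /= uw] := cAB.
(* Expanding [u * A + w * B = 1] along [p] gives a Bezout relation for [px] and [py]. *)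
pose s := u * qy + w * ry; pose t := u * qx + w * rx.
have st : px * s - py * t = 1 by rewrite -uw /s /t /A /B; ring.
pose zx := vx - b * qx - c * rx; pose zy := vy - b * qy - c * ry.
have z0 : px * zy = zx * py.
  by apply/eqP; rewrite -subr_eq0 -(subrr D) {2}DE /zx /zy /D /A /B; apply/eqP; ring.
(* Since [z] is parallel to [p] and [det(p, (t, s)) = 1], the factor of [z] over [p] can only be
   [det(z, (t, s))]. *)
pose a := zx * s - zy * t.
have ax : a * px = zx.
  transitivity (zx * s * px - px * zy * t); first by rewrite /a; ring.
  by rewrite z0 -[RHS]mulr1 -st; ring.
have ay : a * py = zy.
  transitivity (zx * py * s - zy * t * py); first by rewrite /a; ring.
  by rewrite -z0 -[RHS]mulr1 -st; ring.
have aA : a * A = vx * qy - qx * vy + c * (qx * ry - rx * qy).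
  transitivity (a * px * qy - qx * (a * py)); first by rewrite /A; ring.
  by rewrite ax ay /zx /zy; ring.
exists a, b, c; split=> //.
- by rewrite -(pmulr_lge0 _ A0) aA addr_ge0 // mulr_ge0.
- by rewrite ax /zx; ring.
- by rewrite ay /zy; ring.
Qed.

(** * The Diophantine system in coordinates *)

Lemma ord2P (P : 'I_2 -> Prop) : P 0 -> P 1 -> forall i, P i.
Proof.
move=> P0 P1 [[|[|//]] i]; first by rewrite (_ : Ordinal i = 0) //; exact: val_inj.
by rewrite (_ : Ordinal i = 1) //; exact: val_inj.
Qed.

Lemma ord3P (P : 'I_3 -> Prop) : P 0 -> P 1 -> P 2 -> forall i, P i.
Proof.
move=> P0 P1 P2 [[|[|[|//]]] i].
- by rewrite (_ : Ordinal i = 0) //; exact: val_inj.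
- by rewrite (_ : Ordinal i = 1) //; exact: val_inj.
- by rewrite (_ : Ordinal i = 2) //; exact: val_inj.
Qed.

Lemma sum_ord3 (V : nmodType) (F : 'I_3 -> V) : \sum_i F i = F 0 + F 1 + F 2.
Proof.
rewrite !big_ord_recl big_ord0 addr0 addrA.
by congr (F _ + F _ + F _); exact: val_inj.
Qed.

Lemma solvable_atP (M0 : 'M[int]_(2, 3)) (n : 'cV[int]_2) (N : int) :
  solvable_at M0 n N <->
  exists a b c : int, [/\ 0 <= a, 0 <= b, 0 <= c,
    a * xc M0 0 + b * xc M0 1 + c * xc M0 2 = N * n 0 0 &
    a * yc M0 0 + b * yc M0 1 + c * yc M0 2 = N * n 1 0].
Proof.
split=> [[x [x0 /matrixP e]]|[a [b [c [a0 b0 c0 ex ey]]]]].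
  exists (x 0 0), (x 1 0), (x 2 0); split=> //.
  - by have := e 0 0; rewrite !mxE sum_ord3 /xc => <-; ring.
  - by have := e 1 0; rewrite !mxE sum_ord3 /yc => <-; ring.
exists (\col_i [:: a; b; c]`_i); split.
  by apply: ord3P; rewrite mxE.
apply/matrixP=> i j; rewrite ord1 !mxE sum_ord3 !mxE /=.
by elim/ord2P: i; rewrite -?ex -?ey /xc /yc; ring.
Qed.

(** Take the least natural [k] from which on every [N] is solvable; then [f = k - 1]. If [d != 0]
    and [k - 1] were at least [a / d], then [k - 1] would be solvable. *)
Lemma f_lt_quotP (M0 : 'M[int]_(2, 3)) (n : 'cV[int]_2) (a d : int) :
  0 <= a -> 0 <= d ->
  (forall N : int, N < 0 -> ~ solvable_at M0 n N) ->
  (forall N : int, 0 <= N -> N * d = 0 \/ a <= N * d -> solvable_at M0 n N) ->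
  f_lt_quot M0 n a d.
Proof.
move=> a0 d0 neg pos.
have large (N : int) : a <= N -> solvable_at M0 n N.
  move=> aN; apply: pos; first exact: le_trans aN.
  have [->|dn0] := eqVneq d 0; first by left; rewrite mulr0.
  by right; nia.
pose P k := `[< forall N : int, k%:Z <= N -> solvable_at M0 n N >].
have exP : exists k, P k.
  by exists `|a|%N; apply/asboolP => N; rewrite gez0_abs //; exact: large.
case: (ex_minnP exP) => k /asboolP Pk kmin.
(* For [k = 0] this is the value [-1], unsolvable because it is negative; otherwise minimality of
   [k] applies. *)
have unsolv : ~ solvable_at M0 n (k%:Z - 1).
  case: k Pk kmin => [|k] Pk kmin; first exact: neg.
  move=> solvk; suff /kmin : P k by rewrite ltnn.
  apply/asboolP => N; rewrite le_eqVlt => /predU1P[<-|kN].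
    by move: solvk; rewrite -addn1 PoszD addrK.
  by apply: Pk; lia.
exists (k%:Z - 1); split.
  split=> // N' unsolv'; rewrite leNgt; apply/negP => kN'.
  by apply: unsolv'; apply: Pk; lia.
move=> dn0; have d_gt0 : 0 < d by rewrite lt_def dn0.
rewrite ltr_pdivlMr ?ltr0z // -rmorphM ltr_int ltNge; apply/negP => le_a.
apply: unsolv; apply: pos; last by right.
by nia.
Qed.

(** * Sectors of the cone and their closures *)

Section Sector.
Variables (R : realType) (M0 : 'M[int]_(2, 3)).
Hypothesis same_sign : forall i j : 'I_3, 0 < xc M0 i * xc M0 j.

Lemma xc_neq0 (i : 'I_3) : xc M0 i != 0.
Proof. by apply/eqP => xi0; have := same_sign i i; rewrite xi0 mul0r. Qed.

Lemma col_slopeE (i : 'I_3) :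
  col_slope R M0 i = (yc M0 i)%:~R / (xc M0 i)%:~R.
Proof. by rewrite /col_slope /slope /toRmx !mxE. Qed.

(** [Y_ij = x_i x_j (y_j / x_j - y_i / x_i)], and [x_i x_j > 0]. *)
Lemma Y_gt0 (i j : 'I_3) : col_slope R M0 i < col_slope R M0 j -> 0 < Y M0 i j.
Proof.
rewrite !col_slopeE -subr_gt0 => lt_ij.
rewrite -(ltr0z R).
have xi : (xc M0 i)%:~R != 0 :> R by rewrite intr_eq0 xc_neq0.
have xj : (xc M0 j)%:~R != 0 :> R by rewrite intr_eq0 xc_neq0.
have xij : 0 < (xc M0 i * xc M0 j)%:~R :> R by rewrite ltr0z.
have := mulr_gt0 xij lt_ij; congr (0 < _).
by rewrite /Y !rmorphB !rmorphM /=; field; apply/andP.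
Qed.

Lemma closed_halfplane (a b : R) :
  closed [set v : 'cV[R]_2 | 0 <= a * v 0 0 + b * v 1 0].
Proof.
apply: (@preimage_closed _ _ (fun v : 'cV[R]_2 => a * v 0 0 + b * v 1 0)
  [set x | 0 <= x]); last exact: closed_ge.
move=> v _; apply: (@continuousD _ _ _ (fun v : 'cV[R]_2 => a * v 0 0)
  (fun v => b * v 1 0)); apply: continuousM;
  by [exact: cst_continuous|exact: coord_continuous].
Qed.

(** Clearing denominators turns the slope bounds into weak linear inequalities, which, unlike the
    slopes, pass to the closure. *)
Lemma Omega_halfplanes (i j : 'I_3) (v : 'cV[R]_2) : Omega M0 i j v ->
  [/\ 0 <= (xc M0 i)%:~R * v 0 0 + 0 * v 1 0,
      0 <= - (yc M0 i)%:~R * v 0 0 + (xc M0 i)%:~R * v 1 0 &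
      0 <= (yc M0 j)%:~R * v 0 0 + - (xc M0 j)%:~R * v 1 0].
Proof.
case=> -[t [t0 vE]] v0 /andP[]; rewrite !col_slopeE /slope => lti ltj.
(* The product is the sum of the [x_k x_l t_l >= 0], and it is nonzero. *)
have xv (k : 'I_3) : 0 < (xc M0 k)%:~R * v 0 0.
  rewrite lt_def mulf_neq0 ?intr_eq0 ?xc_neq0 //= vE mxE mulr_sumr.
  apply: sumr_ge0 => l _; rewrite mxE mulrA mulr_ge0 // -rmorphM ler0z.
  exact: ltW (same_sign k l).
have x0 (k : 'I_3) : (xc M0 k)%:~R != 0 :> R by rewrite intr_eq0 xc_neq0.
have di : 0 < v 1 0 / v 0 0 - (yc M0 i)%:~R / (xc M0 i)%:~R by rewrite subr_gt0.
have dj : 0 < (yc M0 j)%:~R / (xc M0 j)%:~R - v 1 0 / v 0 0 by rewrite subr_gt0.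
split; first by rewrite mul0r addr0 ltW.
- have := ltW (mulr_gt0 (xv i) di); congr (0 <= _).
  by field; apply/andP.
- have := ltW (mulr_gt0 (xv j) dj); congr (0 <= _).
  by field; apply/andP.
Qed.

Lemma closure_Omega_halfplanes (i j : 'I_3) (n : 'cV[int]_2) :
  closure (Omega M0 i j) (toRmx R n) ->
  [/\ 0 <= xc M0 i * n 0 0, 0 <= n 1 0 * xc M0 i - n 0 0 * yc M0 i &
      0 <= n 0 0 * yc M0 j - n 1 0 * xc M0 j].
Proof.
have half (a b : int) :
    (forall v, Omega M0 i j v -> 0 <= a%:~R * v 0 0 + b%:~R * v 1 0 :> R) ->
    closure (Omega M0 i j) (toRmx R n) -> 0 <= a * n 0 0 + b * n 1 0.
  move=> sub cl.
  have := closed_halfplane (closure_subset sub cl); rewrite /= !mxE.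
  by rewrite -!rmorphM -rmorphD ler0z.
move=> cl; split.
- have := half (xc M0 i) 0; rewrite mul0r addr0; apply=> // v /Omega_halfplanes.
  by case.
- have := half (- yc M0 i) (xc M0 i); rewrite rmorphN /=.
  rewrite (_ : - _ * _ + _ * _ = n 1 0 * xc M0 i - n 0 0 * yc M0 i); last by ring.
  by apply=> // v /Omega_halfplanes[].
- have := half (yc M0 j) (- xc M0 j); rewrite rmorphN /=.
  rewrite (_ : _ * _ + - _ * _ = n 0 0 * yc M0 j - n 1 0 * xc M0 j); last by ring.
  by apply=> // v /Omega_halfplanes[].
Qed.

Lemma closure_Omega_xpos (i j : 'I_3) (n : 'cV[int]_2) : n != 0 ->
  closure (Omega M0 i j) (toRmx R n) -> forall k, 0 < xc M0 k * n 0 0.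
Proof.
move=> n0 /closure_Omega_halfplanes[xn di dj] k.
(* On the vertical axis the two determinant inequalities give [n_2] opposite weak signs, forcing
   [n = 0]. *)
have nx : n 0 0 != 0.
  apply: contra_neq n0 => nx0; apply/matrixP => l m; rewrite ord1 mxE.
  elim/ord2P: l => //; move: di dj (same_sign i j); rewrite nx0 !mul0r subr0 sub0r.
  move: (n 1 0) (xc M0 i) (xc M0 j) => z x x'; nia.
have := same_sign i k; have := xc_neq0 k; have := xc_neq0 i.
move: xn nx; move: (n 0 0) (xc M0 i) (xc M0 k) => z x x'; nia.
Qed.

(** Multiply the first equation by [n_1]: the left side becomes nonnegative, the right side is
    [N n_1^2 < 0]. *)
Lemma unsolvable_neg (n : 'cV[int]_2) (N : int) :
  (forall k, 0 < xc M0 k * n 0 0) -> N < 0 -> ~ solvable_at M0 n N.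
Proof.
move=> xn N0 /solvable_atP[a [b [c [a0 b0 c0 ex _]]]].
have := xn 0; have := xn 1; have := xn 2; move: ex.
move: (n 0 0) (xc M0 0) (xc M0 1) (xc M0 2) => z x y w ex x0 y0 w0.
have : 0 <= N * z * z.
  rewrite -ex !mulrDl -!mulrA !addr_ge0 // mulr_ge0 // ltW //.
have z0 : z != 0 by apply/eqP => z0; move: x0; rewrite z0 mulr0.
nia.
Qed.

End Sector.

Theorem theorem9 (R : realType) (M0 : 'M[int]_(2, 3))
    (hull : ~ @col_hull R M0 0)
    (same_sign : forall i j : 'I_3, 0 < xc M0 i * xc M0 j)
    (slope12 : col_slope R M0 0 < col_slope R M0 1)
    (slope23 : col_slope R M0 1 < col_slope R M0 2)
    (cop12_13 : coprimez (Y M0 0 1) (Y M0 0 2))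
    (cop12_23 : coprimez (Y M0 0 1) (Y M0 1 2))
    (cop13_23 : coprimez (Y M0 0 2) (Y M0 1 2)) :
  (forall n : 'cV[int]_2, n != 0 ->
     closure (@Omega R M0 0 1) (toRmx R n) ->
     f_lt_quot M0 n
       (Y M0 0 1 * Y M0 0 2 - Y M0 0 1 - Y M0 0 2 + 1)
       (n 1 0 * xc M0 0 - n 0 0 * yc M0 0)) /\
  (forall n : 'cV[int]_2, n != 0 ->
     closure (@Omega R M0 1 2) (toRmx R n) ->
     f_lt_quot M0 n
       (Y M0 1 2 * Y M0 0 2 - Y M0 1 2 - Y M0 0 2 + 1)
       (n 0 0 * yc M0 2 - n 1 0 * xc M0 2)).
Proof.
have Y12 : 0 < Y M0 0 1 by exact: Y_gt0 slope12.
have Y23 : 0 < Y M0 1 2 by exact: Y_gt0 slope23.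
have Y13 : 0 < Y M0 0 2 by exact: Y_gt0 (lt_trans slope12 slope23).
have boundE (A B : int) : A * B - A - B + 1 = (A - 1) * (B - 1) by ring.
have bound_ge0 (A B : int) : 0 < A -> 0 < B -> 0 <= (A - 1) * (B - 1) by nia.
split=> n n0 cl; rewrite boundE; have xn := closure_Omega_xpos same_sign n0 cl;
  have [_ d1 d2] := closure_Omega_halfplanes same_sign cl;
  (apply: f_lt_quotP => // [|N|N N0 hN];
    [exact: bound_ge0|exact: unsolvable_neg|apply/solvable_atP]).
- apply: (@sector_nneg_combination (xc M0 0) (yc M0 0) (xc M0 1) (yc M0 1)
    (xc M0 2) (yc M0 2)) => //; first exact: ltW.
    by rewrite (_ : _ - _ = N * (n 0 0 * yc M0 1 - n 1 0 * xc M0 1)) ?mulr_ge0 //; ring.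
  rewrite (_ : _ - N * _ * _ = N * (n 1 0 * xc M0 0 - n 0 0 * yc M0 0)) //.
  by ring.
(* Exchanging coordinates and reversing the columns each flip the sign of a determinant, so the
   [Y_ij] stay positive. *)
- have swap (i j : 'I_3) : yc M0 j * xc M0 i - yc M0 i * xc M0 j = Y M0 i j.
    by rewrite /Y; ring.
  have [||||||a [b [c [a0 b0 c0 ey ex]]]] := @sector_nneg_combination
    (yc M0 2) (xc M0 2) (yc M0 1) (xc M0 1) (yc M0 0) (xc M0 0)
    (N * n 1 0) (N * n 0 0); rewrite ?swap //.
  + exact: ltW.
  + by rewrite coprimez_sym.
  + by rewrite (_ : _ - _ = N * (n 1 0 * xc M0 1 - n 0 0 * yc M0 1)) ?mulr_ge0 //; ring.
  + rewrite (_ : _ - N * _ * _ = N * (n 0 0 * yc M0 2 - n 1 0 * xc M0 2)) //.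
    by ring.
  + by exists c, b, a; split; rewrite // -?ex -?ey; ring.
Qed.
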